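(* Let $p$ be the mesh pattern $(12,R)$ with $R=\{0,1,2\}^2\setminus\{(1,1)\}$, let $E(t,u)=\sum_{n\ge0}t^n\sum_{\sigma\in K_n}u^{p(\sigma)}$, and let $P(t)=\sum_{n\ge0}|K_n(p)|t^n$. Then $$P(t)=\frac{t^2}{1+t}+\frac{(1+2t)A(t)}{(1+t)^2},\qquad E(t,u)=\frac{t^2(1-u)}{1+t}+\frac{(1+2t+ut^2)A(t)}{(1+t)^2}.$$ The initial terms of $E(t,u)$ are $1+t+2t^4+14t^5+(88+2u)t^6+(636+10u)t^7+(5174+68u)t^8+\cdots$.
   Context: A permutation $\sigma=\sigma_1\cdots\sigma_n$ of $\{1,\dots,n\}$ is a king permutation if $|\sigma_{i+1}-\sigma_i|>1$ for all $1\le i\le n-1$. $K_n$ is the set of king permutations of length $n$ ($K_0$ = the empty permutation, $K_1=\{1\}$) and $A(t)=\sum_{n\ge0}|K_n|t^n$ (known to equal $\sum_{n\ge0}n!\,t^n(1-t)^n/(1+t)^n$). For a mesh pattern $p=(12,R)$ with $R\subseteq\{0,1,2\}^2$, an occurrence of $p$ in $\sigma\in S_n$ is a pair of positions $i_1<i_2$ with $\sigma_{i_1}<\sigma_{i_2}$ such that for every $(x,y)\in R$ there is no position $m$ with $i_x<m<i_{x+1}$ and $v_y<\sigma_m<v_{y+1}$, where $i_0=0$, $i_3=n+1$, $v_0=0$, $v_1=\sigma_{i_1}$, $v_2=\sigma_{i_2}$, $v_3=n+1$ (first coordinate of a box indexes positions, second values). $p(\sigma)$ is the number of occurrences of $p$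 in $\sigma$; $K_n(p)$ is the set of king $n$-permutations with $p(\sigma)=0$. *)

(* Defs.v *)
From HB Require Import structures.
From mathcomp Require Import all_boot all_fingroup all_algebra.
From mathcomp Require Import boolp.

Set Implicit Arguments.
Unset Strict Implicit.
Unset Printing Implicit Defensive.

Import GRing.Theory.

Local Open Scope ring_scope.

(* Formal power series in one variable, as a comUnitRingType: [f / g] below is
   division of formal power series, meaningful as soon as the constant
   coefficient of [g] is a unit. *)

Record fps (R : Type) := Fps { fps_coef : nat -> R }.

Arguments Fps {R} fps_coef.

Notation "f ``_ n" := (fps_coef f n)
  (at level 3, n at level 2, left associativity, format "f ``_ n") : ring_scope.

HB.instance Definition _ (R : Type) := gen_eqMixin (fps R).
HB.instance Definition _ (R : Type) := gen_choiceMixin (fps R).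

Lemma fpsP (R : Type) (f g : fps R) :
  (forall n, fps_coef f n = fps_coef g n) -> f = g.
Proof. by case: f g => [f] [g] /= fg; congr Fps; apply/funext. Qed.

Section FpsZmodule.
Variable R : comNzRingType.
Implicit Types f g h : fps R.

Definition fps_zero : fps R := Fps (fun=> 0).
Definition fps_opp f : fps R := Fps (fun n => - f``_n).
Definition fps_add f g : fps R := Fps (fun n => f``_n + g``_n).

Lemma fps_addA : associative fps_add.
Proof. by move=> f g h; apply: fpsP => n /=; rewrite addrA. Qed.
Lemma fps_addC : commutative fps_add.
Proof. by move=> f g; apply: fpsP => n /=; rewrite addrC. Qed.
Lemma fps_add0 : left_id fps_zero fps_add.
Proof. by move=> f; apply: fpsP => n /=; rewrite add0r. Qed.
Lemma fps_addN : left_inverse fps_zero fps_opp fps_add.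
Proof. by move=> f; apply: fpsP => n /=; rewrite addNr. Qed.

HB.instance Definition _ :=
  GRing.isZmodule.Build (fps R) fps_addA fps_addC fps_add0 fps_addN.

Definition fps_one : fps R := Fps (fun n => (n == 0%N)%:R).
Definition fps_mul f g : fps R :=
  Fps (fun n => \sum_(i < n.+1) f``_i * g``_(n - i)).

Let trunc m f : {poly R} := \poly_(i < m.+1) f``_i.

Let coef_trunc m f n : (n <= m)%N -> (trunc m f)`_n = f``_n.
Proof. by move=> le_nm; rewrite coef_poly ltnS le_nm. Qed.

Let coef_mul_eq m f g (p q : {poly R}) :
  (forall n, (n <= m)%N -> p`_n = f``_n) ->
  (forall n, (n <= m)%N -> q`_n = g``_n) ->
  forall n, (n <= m)%N -> (p * q)`_n = (fps_mul f g)``_n.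
Proof.
move=> pf qg n le_nm; rewrite coefM /=; apply: eq_bigr => i _.
rewrite pf; last by rewrite (leq_trans _ le_nm) // -ltnS.
by rewrite qg // (leq_trans (leq_subr _ _) le_nm).
Qed.

Lemma fps_mulA : associative fps_mul.
Proof.
move=> f g h; apply: fpsP => n; pose T k := @coef_trunc n k.
rewrite -(coef_mul_eq (T f) (coef_mul_eq (T g) (T h)) (leqnn n)) mulrA.
by rewrite -(coef_mul_eq (coef_mul_eq (T f) (T g)) (T h) (leqnn n)).
Qed.

Lemma fps_mulC : commutative fps_mul.
Proof.
move=> f g; apply: fpsP => n; pose T k := @coef_trunc n k.
rewrite -(coef_mul_eq (T f) (T g) (leqnn n)) mulrC.
exact: (coef_mul_eq (T g) (T f) (leqnn n)).
Qed.

Lemma fps_mul1 : left_id fps_one fps_mul.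
Proof.
move=> f; apply: fpsP => n /=; rewrite big_ord_recl /= mul1r subn0.
by rewrite big1 ?addr0 // => i _; rewrite mul0r.
Qed.

Lemma fps_mulDl : left_distributive fps_mul fps_add.
Proof.
move=> f g h; apply: fpsP => n /=.
by rewrite -big_split /=; apply: eq_bigr => i _; rewrite mulrDl.
Qed.

Lemma fps_oner_neq0 : fps_one != 0.
Proof.
by apply/eqP=> /(congr1 (fun f : fps R => f``_0))/eqP /=; rewrite oner_eq0.
Qed.

HB.instance Definition _ := GRing.Zmodule_isComNzRing.Build (fps R)
  fps_mulA fps_mulC fps_mul1 fps_mulDl fps_oner_neq0.

Definition fpsC (a : R) : fps R := Fps (fun n => if n == 0%N then a else 0).
Definition fpsX : fps R := Fps (fun n => (n == 1%N)%:R).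

End FpsZmodule.

Arguments fpsX {R}.

Section FpsCoef.
Variable R : comNzRingType.
Implicit Types f g : fps R.

Lemma coef_fps0 n : (0 : fps R)``_n = 0. Proof. by []. Qed.
Lemma coef_fps1 n : (1 : fps R)``_n = (n == 0%N)%:R. Proof. by []. Qed.
Lemma coef_fpsD f g n : (f + g)``_n = f``_n + g``_n. Proof. by []. Qed.
Lemma coef_fpsN f n : (- f)``_n = - f``_n. Proof. by []. Qed.
Lemma coef_fpsM f g n : (f * g)``_n = \sum_(i < n.+1) f``_i * g``_(n - i).
Proof. by []. Qed.

End FpsCoef.

Section FpsUnitRing.
Variable R : comUnitRingType.
Implicit Types f g : fps R.

Definition fps_unit : {pred fps R} := fun f => f``_0 \is a GRing.unit.

(* The first [m] coefficients of the inverse of [f], from the recurrence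
   f_0 g_n = [n = 0] - \sum_(i < n) f_(n - i) g_i. *)
Fixpoint fps_inv_seq f m : seq R :=
  if m is n.+1 then
    let s := fps_inv_seq f n in
    rcons s ((f``_0)^-1 * ((n == 0%N)%:R - \sum_(i < n) f``_(n - i) * s`_i))
  else [::].

(* Non-units are mapped to themselves, as required by unitRingType. *)
Definition fps_inv f : fps R :=
  if f \in fps_unit then Fps (fun n => (fps_inv_seq f n.+1)`_n) else f.

Let size_inv_seq f m : size (fps_inv_seq f m) = m.
Proof. by elim: m => //= m IHm; rewrite size_rcons IHm. Qed.

Let nth_inv_seq f m n :
  (n < m)%N -> (fps_inv_seq f m)`_n = (fps_inv_seq f n.+1)`_n.
Proof.
elim: m => // m IHm; rewrite ltnS leq_eqVlt => /predU1P[-> //|lt_nm].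
by rewrite -(IHm lt_nm) [LHS]/= nth_rcons size_inv_seq lt_nm.
Qed.

Let inv_seqE f n : (fps_inv_seq f n.+1)`_n =
  (f``_0)^-1 * ((n == 0%N)%:R - \sum_(i < n) f``_(n - i) * (fps_inv_seq f i.+1)`_i).
Proof.
rewrite [LHS]/= nth_rcons size_inv_seq ltnn eqxx; congr (_ * (_ - _)).
by apply: eq_bigr => i _; rewrite nth_inv_seq.
Qed.

Lemma fps_mulVx : {in fps_unit, left_inverse 1 fps_inv *%R}.
Proof.
move=> f Uf; have Uf0 : f``_0 \is a GRing.unit by [].
rewrite /fps_inv Uf; apply: fpsP => n; rewrite coef_fpsM big_ord_recr.
set S := (X in X = _); have -> : S =
  (\sum_(i < n) f``_(n - i) * (fps_inv_seq f i.+1)`_i)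
  + f``_0 * (fps_inv_seq f n.+1)`_n.
  rewrite /S [X in _ = _ + X]mulrC; congr (_ + _ * f``_(_)); last exact: subnn.
  by apply: eq_bigr => i _; rewrite mulrC.
by rewrite inv_seqE mulVKr // addrC subrK.
Qed.

Lemma fps_unitPl f g : g * f = 1 -> fps_unit f.
Proof.
move/(congr1 (fun h : fps R => h``_0)); rewrite coef_fpsM big_ord1 subnn => gf.
by apply/unitrPr; exists g``_0; rewrite mulrC.
Qed.

Lemma fps_inv_out : {in [predC fps_unit], fps_inv =1 id}.
Proof. by move=> f /negPf Uf; rewrite /fps_inv Uf. Qed.

HB.instance Definition _ := GRing.ComNzRing_hasMulInverse.Build (fps R)
  fps_mulVx fps_unitPl fps_inv_out.

Lemma fps_unitE f : (f \is a GRing.unit) = (f``_0 \is a GRing.unit).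
Proof. by []. Qed.

Lemma fps_unit1DX : (1 + fpsX : fps R) \is a GRing.unit.
Proof. by rewrite fps_unitE coef_fpsD /= addr0 unitr1. Qed.

End FpsUnitRing.

(* A permutation of {1, ..., n} is [s : 'S_n], position i (resp. value) of
   {1, ..., n} being represented by the ordinal i - 1 of 'I_n. *)

Definition king n (s : 'S_n) : bool :=
  [forall i : 'I_n, forall j : 'I_n,
     (j == i.+1 :> nat) ==> (1 < `|(s j)%:Z - (s i)%:Z|)].

Definition kings n : {set 'S_n} := [set s | king s].

(* [mesh_lines n a b] lists the coordinates 0, a, b, n + 1 of the grid lines
   bounding the boxes, where a and b are 1-based. *)
Definition mesh_lines (n a b k : nat) : nat := nth 0%N [:: 0%N; a; b; n.+1] k.

Definition in_box n (s : 'S_n) (i1 i2 : 'I_n) (b : 'I_3 * 'I_3) (m : 'I_n) :=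
  let pos := mesh_lines n i1.+1 i2.+1 in
  let val := mesh_lines n (s i1).+1 (s i2).+1 in
  (pos b.1 < m.+1 < pos b.1.+1)%N && (val b.2 < (s m).+1 < val b.2.+1)%N.

Definition mesh12_occ (B : {set 'I_3 * 'I_3}) n (s : 'S_n) (i1 i2 : 'I_n) :=
  [&& (i1 < i2)%N, (s i1 < s i2)%N &
      [forall b in B, ~~ [exists m : 'I_n, in_box s i1 i2 b m]]].

Definition mesh12_count (B : {set 'I_3 * 'I_3}) n (s : 'S_n) : nat :=
  #|[set i : 'I_n * 'I_n | mesh12_occ B s i.1 i.2]|.

Definition kings_avoiding (B : {set 'I_3 * 'I_3}) n : {set 'S_n} :=
  [set s in kings n | mesh12_count B s == 0%N].

Definition king_gf (R : comNzRingType) : fps R := Fps (fun n => #|kings n|%:R).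

Definition king_avoid_gf (R : comNzRingType) (B : {set 'I_3 * 'I_3}) : fps R :=
  Fps (fun n => #|kings_avoiding B n|%:R).

(* Bivariate series: t is [fpsX] and u is the indeterminate 'X of {poly R}. *)
Definition king_distr_gf (R : comNzRingType) (B : {set 'I_3 * 'I_3}) :
    fps {poly R} :=
  Fps (fun n => \sum_(s in kings n) 'X^(mesh12_count B s)).

Definition all_but_center : {set 'I_3 * 'I_3} :=
  [set~ (Ordinal (isT : 1 < 3)%N, Ordinal (isT : 1 < 3)%N)].

(* Main.v *)
(* Since every box but the central one is shaded, a pair of positions is an
   occurrence exactly when it consists of the first and last positions and they
   carry the minimum and the maximum. So each permutation has at most one
   occurrence, and E = A + (u - 1) B, where B counts the king permutations of
   length n >= 2 with sigma_1 = 1 and sigma_n = n. Let C count those with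
   sigma_1 = 1. Deleting an initial 1 leaves an arbitrary king permutation not
   starting with its minimum, so (1 + t) C = t A; deleting a final n gives in the
   same way (1 + t) B = t C - t^2, the correction coming from the permutation of
   length 1, whose entry is both its minimum and its maximum. *)
Require Import Defs.
From mathcomp Require Import all_boot all_fingroup all_algebra zify ring.

Set Implicit Arguments.
Unset Strict Implicit.
Unset Printing Implicit Defensive.

Import GRing.Theory.

(** * King permutations as words, and deletion of an end letter *)

Definition far (x y : nat) := (x.+1 < y) || (y.+1 < x).

(** A list model of [kings n]: deleting an end letter is a list operation, and the counts can be
    evaluated. *)
Definition king_words n := [seq w <- permutations (iota 0 n) | sorted far w].

(* Values are shifted to 0, ..., n - 1, so these say that a word of length n
   starts with its minimum and ends with its maximum; both defaults make the
   empty word fail the test. *)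
Definition starts_min (w : seq nat) := head 1 w == 0.
Definition ends_max n (w : seq nat) := (last n w).+1 == n.

Lemma king_words_uniq n : uniq (king_words n).
Proof. exact/filter_uniq/permutations_uniq. Qed.

Lemma mem_king_words n w :
  (w \in king_words n) = sorted far w && perm_eq w (iota 0 n).
Proof. by rewrite mem_filter mem_permutations. Qed.

Lemma size_king_words n w : w \in king_words n -> size w = n.
Proof. by rewrite mem_king_words => /andP[_ /perm_size ->]; rewrite size_iota. Qed.

(** The only new adjacent pair is 0 and the shifted old head, which are far apart exactly when the
    old head is not 0. *)
Lemma king_word_cons0 n w :
  (0 :: map S w \in king_words n.+1) = (w \in king_words n) && ~~ starts_min w.
Proof.
have permS v : perm_eq (map S w) (map S v) = perm_eq w v.
  by apply/idP/idP; [apply/perm_map_inj/succn_inj | apply: perm_map].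
rewrite !mem_king_words /= perm_cons (iotaDl 1 0) permS andbAC; congr (_ && _).
case: w {permS} => //= x w; rewrite andbC (@path_map _ _ S) /starts_min /= /far -lt0n.
by rewrite ltn0 orbF.
Qed.

Lemma starts_min_king_words n :
  perm_eq (filter starts_min (king_words n.+1))
    (map (fun w => 0 :: map S w) (filter (predC starts_min) (king_words n))).
Proof.
have inj0S : injective (fun w => 0 :: map S w).
  by move=> v w [] /inj_map; apply; apply: succn_inj.
apply: uniq_perm; first exact/filter_uniq/king_words_uniq.
  by rewrite map_inj_uniq //; apply/filter_uniq/king_words_uniq.
move=> w; apply/idP/mapP => [|[v]]; rewrite mem_filter; last first.
  by rewrite /= andbC -king_word_cons0 => Kv ->; rewrite mem_filter Kv.
case/andP; case: w => // x w; rewrite /starts_min /= => /eqP ->{x} Kw.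
(* The letters after the leading 0 are 1, ..., n in some order, hence positive, so [predn] is undone
   by [S]. *)
have wE : w = map S (map predn w).
  rewrite -map_comp map_id_in // => x xw /=; rewrite prednK //.
  move: Kw; rewrite mem_king_words /= perm_cons => /andP[_ /perm_mem wi].
  by move: xw; rewrite wi mem_iota; case/andP.
exists (map predn w); last by rewrite -wE.
by rewrite mem_filter /= andbC -king_word_cons0 -wE.
Qed.

(** The coefficient form of (1 + t) C = t A. *)
Lemma count_starts_min n :
  count starts_min (king_words n.+1) + count starts_min (king_words n)
  = size (king_words n).
Proof.
rewrite -size_filter (perm_size (starts_min_king_words n)) size_map size_filter.
by rewrite addnC count_predC.
Qed.

Lemma king_word_rcons n w :
  (rcons w n.+1 \in king_words n.+2)
  = (w \in king_words n.+1) && ~~ ends_max n.+1 w.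
Proof.
have iotaE : iota 0 n.+2 = rcons (iota 0 n.+1) n.+1.
  by rewrite -cats1 -(iotaD 0 n.+1 1) addn1.
rewrite !mem_king_words iotaE perm_rcons perm_sym perm_rcons perm_cons perm_sym.
rewrite andbAC.
case: (boolP (perm_eq w _)) => [Pw|]; rewrite ?andbF // !andbT.
case: w Pw => [|x w] Pw; first by have := perm_size Pw; rewrite size_iota.
rewrite rcons_cons /= rcons_path; congr (_ && _).
(* The only new adjacent pair is this last letter, at most n, and [n.+1]: it is far unless the
   letter equals n. *)
have : last x w \in iota 0 n.+1 by rewrite -(perm_mem Pw) mem_last.
by rewrite mem_iota /far /ends_max /=; lia.
Qed.

Lemma ends_max_king_words n :
  perm_eq (filter (predI starts_min (ends_max n.+2)) (king_words n.+2))
    (map (rcons^~ n.+1)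
      (filter (predD starts_min (ends_max n.+1)) (king_words n.+1))).
Proof.
apply: uniq_perm; first exact/filter_uniq/king_words_uniq.
  by rewrite map_inj_uniq; [exact/filter_uniq/king_words_uniq | exact: rcons_injl].
(* Words of length [n.+1] are nonempty, so appending a letter keeps the first one. *)
have startE w : w \in king_words n.+1 -> starts_min (rcons w n.+1) = starts_min w.
  by move/size_king_words; case: w.
move=> w; apply/idP/mapP => [|[v]]; rewrite mem_filter /=; last first.
  move=> /andP[/andP[Ev Sv] Kv] ->; rewrite mem_filter /= startE // Sv /=.
  by rewrite /ends_max last_rcons eqxx king_word_rcons Kv.
case/andP => /andP[]; case/lastP: w => // w x.
rewrite /ends_max last_rcons eqSS => Sw /eqP xE; rewrite {x}xE in Sw *.
rewrite king_word_rcons => /andP[Kw Ew]; exists w => //.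
by rewrite mem_filter /= Kw -(startE _ Kw) Sw andbT Ew.
Qed.

Lemma count_ends_max n :
  count (predI starts_min (ends_max n.+2)) (king_words n.+2)
  + count (predI starts_min (ends_max n.+1)) (king_words n.+1)
  = count starts_min (king_words n.+1).
Proof.
rewrite -size_filter (perm_size (ends_max_king_words n)) size_map size_filter.
rewrite -[RHS]size_filter -(count_predC (ends_max n.+1)) !count_filter addnC.
by congr addn; apply: eq_count => w /=; rewrite [starts_min w && _]andbC.
Qed.

(** * Transfer from permutations to words *)

Section Word.
Variable n : nat.
Implicit Type s : 'S_n.

Definition perm_word s := [seq val (s i) | i <- enum 'I_n].

Lemma size_perm_word s : size (perm_word s) = n.
Proof. by rewrite size_map size_enum_ord. Qed.

Lemma nth_perm_word x0 s (i : 'I_n) : nth x0 (perm_word s) i = s i.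
Proof. by rewrite (nth_map i) ?size_enum_ord // nth_ord_enum. Qed.

Lemma perm_word_inj : injective perm_word.
Proof.
move=> s s' E; apply/permP => i; apply: val_inj.
by rewrite -[LHS](nth_perm_word 0) E nth_perm_word.
Qed.

Lemma perm_word_perm s : perm_eq (perm_word s) (iota 0 n).
Proof.
apply: uniq_perm; last 1 first.
- move=> x; rewrite mem_iota add0n /=; apply/mapP/idP => [[i _ ->] | lt_xn]; first exact: ltn_ord.
  by exists (s^-1%g (Ordinal lt_xn)); rewrite ?mem_enum // permKV.
- by rewrite map_inj_uniq ?enum_uniq // => i j /val_inj /perm_inj.
- exact: iota_uniq.
Qed.

Lemma perm_words : perm_eq (map perm_word (enum 'S_n)) (permutations (iota 0 n)).
Proof.
have U : uniq (map perm_word (enum 'S_n)).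
  by rewrite map_inj_uniq ?enum_uniq //; apply: perm_word_inj.
apply: uniq_perm => //; first exact: permutations_uniq.
(* Both lists have n! distinct entries, so one inclusion suffices. *)
apply: (uniq_min_size U _ _).2.
  by move=> w /mapP[s _ ->]; rewrite mem_permutations perm_word_perm.
by rewrite size_permutations ?iota_uniq // size_iota size_map -cardE card_Sn.
Qed.

Lemma king_perm_word s : king s = sorted far (perm_word s).
Proof.
apply/forallP/(sortedP 0) => [H i | H i].
  rewrite size_perm_word => lt_in; have lt_in' := ltnW lt_in.
  have /forallP/(_ (Ordinal lt_in))/implyP/(_ (eqxx _)) := H (Ordinal lt_in').
  rewrite -(nth_perm_word 0 s (Ordinal lt_in')).
  by rewrite -(nth_perm_word 0 s (Ordinal lt_in)) /= /far; lia.
apply/forallP => j; apply/implyP => /eqP Ej.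
have := H i; rewrite size_perm_word -Ej ltn_ord => /(_ isT).
by rewrite !nth_perm_word /far; lia.
Qed.

Lemma big_kings (R : Type) (idx : R) (op : SemiGroup.com_law R)
    (F : seq nat -> R) :
  \big[op/idx]_(s in kings n) F (perm_word s)
  = \big[op/idx]_(w <- king_words n) F w.
Proof.
rewrite big_filter -(perm_big _ perm_words) big_map big_enum_cond.
by apply: eq_bigl => s; rewrite inE king_perm_word.
Qed.

(** * Occurrences of the mesh pattern *)

Lemma mesh_line_between (a b x : nat) : a < b < n -> x < n -> x != a -> x != b ->
  exists2 k : 'I_3,
    mesh_lines n a.+1 b.+1 k < x.+1 < mesh_lines n a.+1 b.+1 k.+1
    & (k == 1 :> nat) = (a < x < b).
Proof.
move=> ab xn xa xb; case: (ltnP x a) => [ltxa|leax].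
  by exists (@Ordinal 3 0 isT); rewrite /mesh_lines /=; lia.
case: (ltnP x b) => [ltxb|lebx].
  by exists (@Ordinal 3 1 isT); rewrite /mesh_lines /=; lia.
by exists (@Ordinal 3 2 isT); rewrite /mesh_lines /=; lia.
Qed.

Lemma mesh12_occ_all_but_centerP s (i j : 'I_n) :
  reflect [/\ 1 < n, i = 0 :> nat, j.+1 = n, s i = 0 :> nat & (s j).+1 = n]
    (mesh12_occ all_but_center s i j).
Proof.
apply: (iffP and3P) => [[ij sij /forall_inP nobox] | [n1 i0 jn si0 sjn]].
  (* A third point lies off the grid lines, hence in some box; every box but the central one is
     shaded and thus empty. *)
  have center m : m != i -> m != j -> (i < m < j) && (s i < s m < s j).
    move=> mi mj.
    have smi : s m != s i by rewrite inj_eq //; apply: perm_inj.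
    have smj : s m != s j by rewrite inj_eq //; apply: perm_inj.
    have [] := @mesh_line_between i j m; rewrite ?ij //= => k xk kE.
    have [] := @mesh_line_between (s i) (s j) (s m); rewrite ?sij //= => l yl lE.
    rewrite -kE -lE; apply/negPn/negP => kl.
    have /nobox/existsP[] : (k, l) \in all_but_center.
      by rewrite !inE; apply: contra kl => /eqP[-> ->].
    by exists m; rewrite /in_box xk yl.
  have n_gt0 : 0 < n by apply: leq_ltn_trans (ltn_ord i).
  have pred_lt : n.-1 < n by rewrite prednK.
  (* The extremes [o] and [M] never lie strictly between two others. Testing [center] at these
     positions pins down [i] and [j]; testing it at the preimages of these values pins down [s i]
     and [s j]. *)
  pose o := Ordinal n_gt0; pose M := Ordinal pred_lt.
  have n_gt1 : 1 < n by move: (ltn_ord j) ij; lia.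
  have i0 : i = 0 :> nat.
    apply/eqP/negPn/negP => ni.
    by have := center o; rewrite -!val_eqE /=; lia.
  have jn : j.+1 = n.
    have jn := ltn_ord j.
    apply/eqP/negPn/negP => nj.
    by have := center M; rewrite -!val_eqE /=; lia.
  have si0 : s i = 0 :> nat.
    apply/eqP/negPn/negP => ni.
    have := center (s^-1%g o); rewrite permKV ltn0 /= andbF => H.
    suff : false by [].
    by apply: H; rewrite -(inj_eq (@perm_inj _ s)) permKV -val_eqE /=; lia.
  split => //.
  have jn' := ltn_ord (s j).
  apply/eqP/negPn/negP => nj.
  have := center (s^-1%g M); rewrite permKV /= => H.
  suff : n.-1 < s j by lia.
  suff /andP[_ /andP[]] : (i < s^-1%g M < j) && (s i < n.-1 < s j) by [].
  by apply: H; rewrite -(inj_eq (@perm_inj _ s)) permKV -val_eqE /=; lia.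
split; try lia.
apply/forall_inP => -[k l]; rewrite !inE => kl; apply/existsP => -[m].
rewrite /in_box /mesh_lines /= i0 jn si0 sjn => /andP[xk yl].
have mn := ltn_ord m; have smn := ltn_ord (s m).
(* The grid lines are now 0, 1, n, n + 1 in both directions, so the outer strips contain no point
   and both indices are 1. *)
case/negP: kl; apply/eqP; congr (_, _); apply: val_inj => /=.
  by case: k xk => [[|[|[|?]]] ?] //=; lia.
by case: l yl => [[|[|[|?]]] ?] //=; lia.
Qed.

Lemma mesh12_count_all_but_center s :
  mesh12_count all_but_center s
  = [&& 1 < n, starts_min (perm_word s) & ends_max n (perm_word s)].
Proof.
rewrite /mesh12_count.
case: (ltnP 1 n) => [n_gt1|n_le1] /=; last first.
  apply: eq_card0 => -[i j]; rewrite inE; apply/negP.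
  by case/mesh12_occ_all_but_centerP => /=; rewrite ltnNge n_le1.
have n_gt0 := ltnW n_gt1.
have pred_lt : n.-1 < n by rewrite prednK.
pose o := Ordinal n_gt0; pose M := Ordinal pred_lt.
rewrite /starts_min /ends_max -nth0 -nth_last size_perm_word.
rewrite (nth_perm_word 1 s o) (nth_perm_word n s M).
case: (boolP (_ && _)) => [/andP[/eqP so /eqP sM] | ends].
  apply: (etrans _ (cards1 (o, M))); apply: eq_card => -[i j]; rewrite !inE.
  apply/mesh12_occ_all_but_centerP/eqP => /= [[_ i0 jn _ _] | [-> ->]].
    by congr (_, _); apply: val_inj => /=; lia.
  by split=> //=; apply: prednK.
apply: eq_card0 => -[i j]; rewrite inE; apply: contraNF ends.
case/mesh12_occ_all_but_centerP => /= _ i0 jn si0 sjn.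
have -> : o = i by apply: val_inj.
have -> : M = j by apply: val_inj => /=; lia.
by rewrite si0 sjn !eqxx.
Qed.
End Word.

(** * Counting king words with and without an occurrence *)

Definition occ_word n w := [&& 1 < n, starts_min w & ends_max n w].
Definition num_occ n := count (occ_word n) (king_words n).
Definition num_avoid n := count (predC (occ_word n)) (king_words n).

(** The term [(n == 0)] stands for the one-letter word: it passes both end tests in
    [count_ends_max], but [1 < n] bars it from [occ_word]. It yields the correction t^2. *)
Lemma num_occSS n :
  num_occ n.+2 + (n == 0) + num_occ n.+1 = count starts_min (king_words n.+1).
Proof.
case: n => [|n]; first by vm_compute.
by rewrite addn0 -count_ends_max.
Qed.

Lemma card_kings n : #|kings n| = num_occ n + num_avoid n.
Proof.
by rewrite count_predC -sum1_card (@big_kings n _ _ _ (fun=> 1)) sum1_size.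
Qed.

Lemma card_kings_avoiding n :
  #|kings_avoiding all_but_center n| = num_avoid n.
Proof.
rewrite /num_avoid -sum1_card -sum1_count [RHS]big_mkcond /=.
rewrite -(@big_kings n _ _ _ (fun w => if ~~ occ_word n w then 1 else 0)).
rewrite -big_mkcondr /=; apply: eq_bigl => s.
by rewrite !inE mesh12_count_all_but_center eqb0.
Qed.

Local Open Scope ring_scope.

Lemma coef_king_distr (R : comNzRingType) n :
  (king_distr_gf R all_but_center)``_n
  = (num_avoid n)%:R + (num_occ n)%:R * 'X.
Proof.
rewrite /= (eq_bigr (fun s => 'X^(occ_word n (perm_word s)))); last first.
  by move=> s _; rewrite mesh12_count_all_but_center.
rewrite (@big_kings n _ _ _ (fun w => 'X^(occ_word n w))) /num_avoid /num_occ.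
elim: (king_words n) => [|w ws IH]; first by rewrite big_nil mul0r addr0.
by rewrite big_cons IH /= !natrD; case: (occ_word n w) => /=; ring.
Qed.

(** * Functional equations for the generating functions *)

Section Fps.
Variable R : comNzRingType.
Implicit Type f : fps R.

Lemma coef_fpsXM f n : (fpsX * f)``_n = if n is m.+1 then f``_m else 0.
Proof.
rewrite coef_fpsM; case: n => [|n]; first by rewrite big_ord1 mul0r.
rewrite big_ord_recl mul0r add0r big_ord_recl mul1r subn1 big1 ?addr0 //.
by move=> i _; rewrite mul0r.
Qed.

Lemma coef_fpsCM (a : R) f n : (fpsC a * f)``_n = a * f``_n.
Proof.
rewrite coef_fpsM big_ord_recl subn0 big1 ?addr0 // => i _.
by rewrite mul0r.
Qed.

Definition num_occ_gf : fps R := Fps (fun n => (num_occ n)%:R).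

(** Eliminates C between (1 + t) C = t A and (1 + t) B = t C - t^2. *)
Lemma num_occ_gf_eq :
  (1 + fpsX) ^+ 2 * num_occ_gf
  = fpsX ^+ 2 * king_gf R - fpsX ^+ 2 * (1 + fpsX).
Proof.
pose C : fps R := Fps (fun n => (count starts_min (king_words n))%:R).
have CE : (1 + fpsX) * C = fpsX * king_gf R.
  apply: fpsP => n; rewrite mulrDl mul1r coef_fpsD !coef_fpsXM.
  by case: n => [|n]; rewrite ?addr0 //= card_kings count_predC -count_starts_min natrD.
have BE : (1 + fpsX) * num_occ_gf = fpsX * C - fpsX ^+ 2.
  apply: fpsP => n; rewrite mulrDl mul1r coef_fpsD expr2 coef_fpsD coef_fpsN.
  rewrite !coef_fpsXM; case: n => [|[|n]] /=.
  - by rewrite subr0 addr0.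
  - by rewrite subr0 addr0.
  by rewrite -num_occSS !natrD /= eqSS; ring.
by rewrite expr2 -mulrA BE mulrBr mulrCA CE; ring.
Qed.

End Fps.

(** With [u] left free, this serves both formulas: [u = 0] gives P = A - B, and [u = fpsC 'X] gives
    E. *)
Lemma solve_num_occ (S : comUnitRingType) (t u A B : S) :
  1 + t \is a GRing.unit ->
  (1 + t) ^+ 2 * B = t ^+ 2 * A - t ^+ 2 * (1 + t) ->
  A + (u - 1) * B = t ^+ 2 * (1 - u) / (1 + t)
                    + (1 + 2 * t + u * t ^+ 2) * A / (1 + t) ^+ 2.
Proof.
move=> Ut BE; have U2 : (1 + t) ^+ 2 \is a GRing.unit by rewrite unitrX.
have divE x : x / (1 + t) * (1 + t) ^+ 2 = x * (1 + t) by rewrite mulrA divrK.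
apply: (mulIr U2); rewrite [RHS]mulrDl divrK // divE.
transitivity (A * (1 + t) ^+ 2 + (u - 1) * ((1 + t) ^+ 2 * B)); first by ring.
by rewrite BE; ring.
Qed.

Theorem theorem3p4 :
  let P : fps int := king_avoid_gf int all_but_center in
  let E : fps {poly int} := king_distr_gf int all_but_center in
  [/\ (let t : fps int := fpsX in
       let A : fps int := king_gf int in
       P = t ^+ 2 / (1 + t) + (1 + 2 * t) * A / (1 + t) ^+ 2),
      (let t : fps {poly int} := fpsX in
       let u : fps {poly int} := fpsC 'X in
       let A : fps {poly int} := king_gf {poly int} in
       E = t ^+ 2 * (1 - u) / (1 + t)
           + (1 + 2 * t + u * t ^+ 2) * A / (1 + t) ^+ 2)
    & [seq fps_coef E n | n <- iota 0 9] =
      [:: 1; 1; 0; 0; 2; 14; 88 + 2 * 'X; 636 + 10 * 'X; 5174 + 68 * 'X]].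
Proof.
split=> [t A|t u A|].
- have := solve_num_occ 0 (fps_unit1DX _) (num_occ_gf_eq int).
  rewrite mul0r addr0 subr0 mulr1 -/t -/A => <-.
  apply: fpsP => n; rewrite sub0r mulN1r coef_fpsD coef_fpsN /=.
  by rewrite card_kings card_kings_avoiding natrD addrC addKr.
- rewrite -(solve_num_occ _ (fps_unit1DX _) (num_occ_gf_eq _)).
  apply: fpsP => n; rewrite [in RHS]mulrBl [in RHS]mul1r coef_king_distr.
  by rewrite !coef_fpsD coef_fpsN coef_fpsCM /= card_kings natrD; ring.
have avoidE : [seq num_avoid n | n <- iota 0 9]
    = [:: 1; 1; 0; 0; 2; 14; 88; 636; 5174]%N by vm_compute.
have occE : [seq num_occ n | n <- iota 0 9]
    = [:: 0; 0; 0; 0; 0; 0; 2; 10; 68]%N by vm_compute.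
rewrite (eq_map (coef_king_distr _)).
(* Zipping the two count lists lets their evaluated forms be rewritten in. *)
have -> : [seq (num_avoid n)%:R + (num_occ n)%:R * 'X | n <- iota 0 9]
  = [seq x.1%:R + x.2%:R * 'X :> {poly int}
     | x <- zip [seq num_avoid n | n <- iota 0 9] [seq num_occ n | n <- iota 0 9]].
  by [].
by rewrite avoidE occE [LHS]/= mul0r !addr0.
Qed.
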